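(* Let $a_{n,k,r}$ denote the number of run-sorted permutations of $[n]$ having $k$ runs and $r$ right-to-left minima ($a_{0,0,0}=1$), and let $A(x,y,z)=\sum_{n,k,r\ge0}a_{n,k,r}\frac{x^n}{n!}y^kz^r$. Then $$\frac{\partial A}{\partial x}=yz\,e^{xz+yz(-x-1)+yze^x},$$ with $\frac{\partial A}{\partial x}\big|_{x=0}=yz$.
   Context: A run of a permutation is a maximal increasing factor of consecutive letters. A permutation of $[n]$ is run-sorted if it is the concatenation of the blocks of a set partition of $[n]$ in block representation (elements increasing in each block, blocks ordered by increasing minima); equivalently the minima of its successive runs are increasing. A right-to-left minimum of $\pi=\pi_1\cdots\pi_n$ is an entry $\pi_i$ with $\pi_i<\pi_j$ for all $j>i$. *)

(* Defs.v *)
From HB Require Import structures.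
From mathcomp Require Import all_boot all_order all_algebra.
From mathcomp Require Import boolp zify.

Set Implicit Arguments.
Unset Strict Implicit.
Unset Printing Implicit Defensive.

Import Order.TTheory GRing.Theory Num.Theory.

(* A permutation of [n] is its one-line word, i.e. an element of
   [permutations (iota 1 n)]. *)

(* Set partitions of [n] in block representation. *)
Definition block_representation (n : nat) (bs : seq (seq nat)) : bool :=
  [&& [::] \notin bs,
      all (sorted ltn) bs,
      sorted ltn [seq head 0 b | b <- bs]
    & perm_eq (flatten bs) (iota 1 n)].

Definition run_sorted (n : nat) (w : seq nat) : bool :=
  `[< exists2 bs, block_representation n bs & w = flatten bs >].

Fixpoint runs (w : seq nat) : seq (seq nat) :=
  if w is x :: w' then
    match runs w' with
    | (y :: b) :: bs =>
        if x < y then (x :: y :: b) :: bs else [:: x] :: (y :: b) :: bs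
    | bs => [:: x] :: bs
    end
  else [::].

Definition rl_minima (w : seq nat) : nat :=
  count (fun i => all (ltn (nth 0 w i)) (drop i.+1 w)) (iota 0 (size w)).

Definition a (n k r : nat) : nat :=
  count (fun w => [&& run_sorted n w, size (runs w) == k & rl_minima w == r])
        (permutations (iota 1 n)).

(* [runs w] is the factorization of [w] into nonempty increasing factors none
   of which extends into its neighbour. *)
Lemma runs_neq0 w : [::] \notin runs w.
Proof.
elim: w => [|x w IH] //=.
case: (runs w) IH => [|[|y b] bs] //=; case: ifP => _;
  by rewrite !inE //= => /norP[_ ->].
Qed.

Lemma runs_flatten w : flatten (runs w) = w.
Proof.
elim: w => [|x w IH] //=.
case E: (runs w) IH (runs_neq0 w) => [|[|y b] bs] /=; rewrite ?E //.
- by move=> <-.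
- by move=> <- _; case: ifP.
Qed.

Lemma runs_increasing w : all (sorted ltn) (runs w).
Proof.
elim: w => [|x w IH] //=.
by case: (runs w) IH => [|[|y b] bs] //=; case: ifP => //= ->.
Qed.

Lemma runs_maximal w :
  sorted (fun b c => head 0 c <= last 0 b) (runs w).
Proof.
elim: w => [|x w IH] //=.
case: (runs w) IH (runs_neq0 w) => [|[|y b] bs] //= H _.
case: ifP => /= [_|]; first by case: bs H.
by rewrite H => /negbT; rewrite -leqNgt => ->.
Qed.

Lemma runs_cat x b s : path ltn x b ->
  exists c cs, runs (x :: b ++ s) = (x :: c) :: cs /\
    subseq [seq head 0 u | u <- cs] [seq head 0 u | u <- runs s].
Proof.
elim: b x => [|y b IHb] x /=.
  move=> _; have := runs_neq0 s.
  case: (runs s) => [|[|u us] vs] //= _; first by exists [::], [::].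
  case: ifP => _.
    by exists (u :: us), vs; split=> //=; exact: (subseq_cons _ u).
  by exists [::], ((u :: us) :: vs); split=> //=; rewrite eqxx subseq_refl.
case/andP=> xy /IHb[c [cs [/= -> H]]].
by rewrite xy; exists (y :: c), cs.
Qed.

Lemma run_sorted_minima n w : w \in permutations (iota 1 n) ->
  run_sorted n w = sorted ltn [seq head 0 b | b <- runs w].
Proof.
rewrite mem_permutations => pw; apply/asboolP/idP; last first.
  move=> H; exists (runs w); last by rewrite runs_flatten.
  by rewrite /block_representation runs_neq0 runs_increasing H runs_flatten.
case=> bs /and4P[nz inc hd _] {pw} ->.
suff: sorted ltn [seq head 0 b | b <- runs (flatten bs)] /\
      head 0 [seq head 0 b | b <- runs (flatten bs)] =
      head 0 [seq head 0 b | b <- bs] by case.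
elim: bs nz inc hd => [|b bs IH] //=.
rewrite inE => /norP[bn nz] /andP[ib inc] hd.
have {IH}[S Hh] := IH nz inc (path_sorted hd).
case: b bn ib hd => [//|x b] _ /= ib hd.
have {S Hh}hd : path ltn x [seq head 0 c | c <- runs (flatten bs)].
  case: bs {nz inc} hd S Hh => [|c bs] //=.
  case: (map _ (runs _)) => [//|u us] /= /andP[xc _] H1 H2.
  by rewrite H1 H2 xc.
have [c [cs [/= -> sub]]] := runs_cat (flatten bs) ib.
by split=> //=; exact: (subseq_path ltn_trans sub hd).
Qed.

Lemma a000 : a 0 0 0 = 1.
Proof.
rewrite /a -(@eq_in_count _ (fun w => [&& sorted ltn [seq head 0 b | b <- runs w],
  size (runs w) == 0 & rl_minima w == 0])) //.
by move=> w Hw; rewrite (run_sorted_minima Hw).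
Qed.

Local Open Scope ring_scope.

(* The ring Q[[x, y, z]]: [f n k r] is the coefficient of x^n y^k z^r. *)
Definition fps := nat -> nat -> nat -> rat.

HB.instance Definition _ := gen_eqMixin fps.
HB.instance Definition _ := gen_choiceMixin fps.

Lemma fpsP (f g : fps) : (forall n k r, f n k r = g n k r) <-> f = g.
Proof.
by split=> [H|-> //]; apply/funext => n; apply/funext => k; apply/funext => r.
Qed.

Definition fps_zero : fps := fun _ _ _ => 0.
Definition fps_opp (f : fps) : fps := fun n k r => - f n k r.
Definition fps_add (f g : fps) : fps := fun n k r => f n k r + g n k r.
Definition monomial (i j l : nat) : fps :=
  fun n k r => [&& n == i, k == j & r == l]%:R.
Definition fps_mul (f g : fps) : fps := fun n k r =>
  \sum_(i < n.+1) \sum_(j < k.+1) \sum_(l < r.+1)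
    f i j l * g (n - i)%N (k - j)%N (r - l)%N.

Fact fps_addA : associative fps_add.
Proof. by move=> f g h; apply/fpsP => n k r; exact: addrA. Qed.
Fact fps_addC : commutative fps_add.
Proof. by move=> f g; apply/fpsP => n k r; exact: addrC. Qed.
Fact fps_add0 : left_id fps_zero fps_add.
Proof. by move=> f; apply/fpsP => n k r; exact: add0r. Qed.
Fact fps_addN : left_inverse fps_zero fps_opp fps_add.
Proof. by move=> f; apply/fpsP => n k r; exact: addNr. Qed.

HB.instance Definition _ :=
  GRing.isZmodule.Build fps fps_addA fps_addC fps_add0 fps_addN.

(* The ring laws are pulled back from trivariate polynomials, with which a
   series agrees up to any given degree. *)
Definition poly_fps (p : {poly {poly {poly rat}}}) : fps :=
  fun n k r => p`_n`_k`_r.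
Definition fps_trunc N (f : fps) : {poly {poly {poly rat}}} :=
  \poly_(i < N) \poly_(j < N) \poly_(l < N) f i j l.

Lemma poly_fpsM p q : poly_fps (p * q) = fps_mul (poly_fps p) (poly_fps q).
Proof.
apply/fpsP => n k r; rewrite /poly_fps /fps_mul coefM !coef_sum.
apply: eq_bigr => i _; rewrite coefM coef_sum.
by apply: eq_bigr => j _; rewrite coefM.
Qed.

Definition eq_upto N (f g : fps) :=
  forall n k r, (n < N)%N -> (k < N)%N -> (r < N)%N -> f n k r = g n k r.

Lemma fps_truncK N f : eq_upto N f (poly_fps (fps_trunc N f)).
Proof.
by move=> n k r Hn Hk Hr; rewrite /poly_fps /fps_trunc !(coef_poly, Hn, Hk, Hr).
Qed.

Lemma eq_uptoM N f f' g g' :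
  eq_upto N f f' -> eq_upto N g g' -> eq_upto N (fps_mul f g) (fps_mul f' g').
Proof.
move=> Hf Hg n k r Hn Hk Hr; apply: eq_bigr => i _; apply: eq_bigr => j _.
apply: eq_bigr => l _; congr (_ * _).
  by apply: Hf; [move: (ltn_ord i)|move: (ltn_ord j)|move: (ltn_ord l)];
    rewrite ltnS => H; apply: leq_ltn_trans H _.
by apply: Hg; apply: leq_ltn_trans (leq_subr _ _) _.
Qed.

Lemma eq_upto_eq f g : (forall N, eq_upto N f g) -> f = g.
Proof.
move=> H; apply/fpsP => n k r; apply: (H (n + k + r).+1); rewrite ltnS.
- by rewrite -addnA leq_addr.
- by rewrite addnAC leq_addl.
- by rewrite leq_addl.
Qed.

Lemma eq_upto_trans N f g h : eq_upto N f g -> eq_upto N g h -> eq_upto N f h.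
Proof. by move=> H1 H2 n k r *; rewrite H1 // H2. Qed.

Lemma eq_upto_sym N f g : eq_upto N f g -> eq_upto N g f.
Proof. by move=> H n k r *; rewrite H. Qed.

Fact fps_mulA : associative fps_mul.
Proof.
move=> f g h; apply: eq_upto_eq => N.
have Kf := @fps_truncK N f; have Kg := @fps_truncK N g.
have Kh := @fps_truncK N h.
apply: (eq_upto_trans (eq_uptoM Kf (eq_uptoM Kg Kh))).
rewrite -!poly_fpsM mulrA !poly_fpsM; apply: eq_upto_sym.
exact: (eq_uptoM (eq_uptoM Kf Kg) Kh).
Qed.

Fact fps_mulC : commutative fps_mul.
Proof.
move=> f g; apply: eq_upto_eq => N.
have Kf := @fps_truncK N f; have Kg := @fps_truncK N g.
apply: (eq_upto_trans (eq_uptoM Kf Kg)).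
by rewrite -poly_fpsM mulrC poly_fpsM; apply/eq_upto_sym/eq_uptoM.
Qed.

Fact fps_mul1 : left_id (monomial 0 0 0) fps_mul.
Proof.
have -> : monomial 0 0 0 = poly_fps 1.
  apply/fpsP => n k r; rewrite /monomial /poly_fps coef1.
  by case: n => [|n]; rewrite ?coef1 ?coef0 //; case: k => [|k];
    rewrite ?coef1 ?coef0.
move=> f; apply: eq_upto_eq => N; have Kf := @fps_truncK N f.
apply: (@eq_upto_trans _ _ (poly_fps (1 * fps_trunc N f))).
  by rewrite poly_fpsM; apply: eq_uptoM.
by rewrite mul1r; apply: eq_upto_sym.
Qed.

Fact fps_mulDl : left_distributive fps_mul fps_add.
Proof.
move=> f g h; apply/fpsP => n k r; rewrite /fps_add /fps_mul -big_split /=.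
apply: eq_bigr => i _; rewrite -big_split; apply: eq_bigr => j _.
by rewrite -big_split; apply: eq_bigr => l _; rewrite mulrDl.
Qed.

Fact fps_oner_neq0 : monomial 0 0 0 != 0.
Proof. by apply/eqP => /(congr1 (fun f : fps => f 0 0 0)%N)/eqP. Qed.

HB.instance Definition _ := GRing.Zmodule_isComNzRing.Build fps
  fps_mulA fps_mulC fps_mul1 fps_mulDl fps_oner_neq0.

Definition X : fps := monomial 1 0 0.
Definition Y : fps := monomial 0 1 0.
Definition Z : fps := monomial 0 0 1.

Definition deriv_x (f : fps) : fps := fun n k r => n.+1%:R * f n.+1 k r.
Definition at_x0 (f : fps) : fps := fun n k r => if n == 0%N then f 0%N k r else 0.

(* exp f = sum_m f^m / m!, meaningful when f has constant term 0: then f^m has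
   no term of total degree < m ([fps_expr_low]), so the terms with m > n + k + r
   do not contribute to the coefficient of x^n y^k z^r. *)
Definition fps_exp (f : fps) : fps := fun n k r =>
  \sum_(m < (n + k + r).+1%N) (f ^+ m) n k r / m`!%:R.

Lemma fps_expr_low (f : fps) m n k r :
  f 0%N 0%N 0%N = 0 -> (n + k + r < m)%N -> (f ^+ m) n k r = 0.
Proof.
move=> f0; elim: m n k r => [//|m IH] n k r H.
rewrite exprS; apply: big1 => i _; apply: big1 => j _; apply: big1 => l _.
case: (posnP (i + j + l)) => [/eqP|pos].
  by rewrite !addn_eq0 => /andP[/andP[/eqP-> /eqP->] /eqP->]; rewrite f0 mul0r.
rewrite IH ?mulr0 //.
by move: (ltn_ord i) (ltn_ord j) (ltn_ord l); lia.
Qed.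

Lemma fps_exp_stable (f : fps) N n k r :
  f 0%N 0%N 0%N = 0 -> (n + k + r < N)%N ->
  fps_exp f n k r = \sum_(m < N) (f ^+ m) n k r / m`!%:R.
Proof.
move=> f0 H; rewrite /fps_exp (big_ord_widen _ (fun m => (f ^+ m) n k r / m`!%:R) H).
rewrite big_mkcond /=; apply: eq_bigr => m _.
by case: ltnP => // Hm; rewrite fps_expr_low ?mul0r.
Qed.

Definition A : fps := fun n k r => (a n k r)%:R / n`!%:R.

Lemma X_const0 : X 0%N 0%N 0%N = 0. Proof. by []. Qed.

Lemma exponent_const0 :
  (X * Z + Y * Z * (- X - 1) + Y * Z * fps_exp X) 0%N 0%N 0%N = 0.
Proof.
have M (f g : fps) : (f * g) 0%N 0%N 0%N = f 0%N 0%N 0%N * g 0%N 0%N 0%N.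
  by rewrite -[LHS]/(fps_mul f g 0 0 0)%N /fps_mul !big_ord1.
have D (f g : fps) : (f + g) 0%N 0%N 0%N = f 0%N 0%N 0%N + g 0%N 0%N 0%N by [].
by rewrite !D !M /= /X /Y /Z /monomial /= !mul0r !addr0.
Qed.

(* Main.v *)
Require Import Defs.
From mathcomp Require Import all_boot all_order all_algebra.
From mathcomp Require Import zify ring.

(** Let [x < y] be the two smallest letters of a run-sorted word [w]. Then
    [w = x W y v] where [W] is increasing and [y v] is again run-sorted: a
    descent inside [W] would start a run whose minimum exceeds the minimum [y]
    of the later run starting at [y]. Conversely every such word is run-sorted;
    compared with [y v] it has one more right-to-left minimum, and one more run
    exactly when [W] is nonempty. Choosing the set of letters of [W] freely
    gives, for [B = dA/dx], the equation
      [dB/dx = B (z + y z (e^x - 1))],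
    which the right-hand side also satisfies, with the same value at [x = 0]. *)

Set Implicit Arguments.
Unset Strict Implicit.
Unset Printing Implicit Defensive.

Import Order.TTheory GRing.Theory Num.Theory.

(** * Run-sorted words *)

Definition run_heads (w : seq nat) := [seq head 0 b | b <- runs w].

Definition rsorted (w : seq nat) := sorted ltn (run_heads w).

Lemma runs_cons x u : exists b bs, runs (x :: u) = (x :: b) :: bs.
Proof.
by have [c [cs [/= -> _]]] := @runs_cat x [::] u isT; exists c, cs.
Qed.

(** The letter [y] cannot prolong the run that ends in [last x u], so a run boundary falls between
    them. *)
Lemma runs_catr x u y v : y <= last x u ->
  runs (x :: u ++ y :: v) = runs (x :: u) ++ runs (y :: v).
Proof.
elim: u x => [|z u IHu] x le_y.
  have [b [bs E]] := runs_cons y v; rewrite /= in E le_y *.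
  by rewrite E ltnNge le_y.
have [b [bs E]] := runs_cons z u.
have := IHu z le_y; rewrite E; move: E => /= E ->.
by rewrite E; case: ifP.
Qed.

Lemma runs_sorted x u : path ltn x u -> runs (x :: u) = [:: x :: u].
Proof.
elim: u x => [//|y u IHu] x /andP[xy /IHu].
by move=> /= ->; rewrite (xy : x < y).
Qed.

Lemma run_heads_subseq w : subseq (run_heads w) w.
Proof.
rewrite -{2}(runs_flatten w) /run_heads; move: (runs_neq0 w).
elim: (runs w) => [//|[|x b] bs IHbs] //; rewrite inE => /norP[_ /IHbs sub].
by rewrite /= eqxx; apply: subseq_trans sub _; apply: suffix_subseq.
Qed.

(** Every letter is at least the head of its own run, and the heads increase starting from [x]. *)
Lemma rsorted_head_min x w z : rsorted (x :: w) -> z \in x :: w -> x <= z.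
Proof.
rewrite /rsorted /run_heads => hs.
rewrite -{1}(runs_flatten (x :: w)) => /flattenP[b bin zb].
have [c [cs E]] := runs_cons x w.
have xb : x <= head 0 b.
  move: hs bin; rewrite E /= => hs; rewrite inE => /orP[/eqP-> //|bcs].
  have /allP/(_ (head 0 b))  := order_path_min ltn_trans hs.
  by rewrite map_f // => /(_ isT) /ltnW.
apply: leq_trans xb _.
have /allP/(_ b bin) := runs_increasing (x :: w).
case: b zb {bin} => [//|u b] /=; rewrite inE => /orP[/eqP-> //|ub].
by move/(order_path_min ltn_trans)/allP/(_ z ub)/ltnW.
Qed.

Lemma rsorted_split x W y v : x < y -> all (ltn y) W -> all (ltn y) v ->
  rsorted (x :: W ++ y :: v) = sorted ltn W && rsorted (y :: v).
Proof.
move=> xy yW yv.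
have [b [bs Ey]] := runs_cons y v.
have heads_v : {subset [seq head 0 c | c <- bs] <= v}.
  have := run_heads_subseq (y :: v).
  by rewrite /run_heads Ey /= eqxx => /mem_subseq.
(* If [W] is empty, [y] joins the run of [x]. The other heads lie in [v] and exceed both letters, so
   replacing the first head [y] by [x] does not affect sortedness. *)
case: W yW => [_|u W yW].
  rewrite /rsorted /run_heads /= in Ey *; rewrite Ey xy /=.
  have allv z : z <= y -> all (ltn z) [seq head 0 c | c <- bs].
    by move=> zy; apply/allP => t /heads_v /(allP yv) /=; apply: leq_ltn_trans.
  by rewrite !(path_sortedE ltn_trans) !allv // ltnW.
have ley : y <= last x (u :: W).
  by have /(allP yW)/ltnW := mem_last u W.
have xW : all (ltn x) (u :: W).
  by apply/allP => t /(allP yW) /=; apply: ltn_trans.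
rewrite /rsorted /run_heads (runs_catr v ley) map_cat.
apply/idP/andP => [|[Ws hs]]; last first.
  rewrite runs_sorted; last by rewrite (path_sortedE ltn_trans) xW.
  by move: hs; rewrite Ey /= xy.
have [c [cs Ex]] := runs_cons x (u :: W); rewrite Ex Ey /= cat_path.
case/andP=> pcs /= /andP[lty hs]; split=> //.
have csW : {subset [seq head 0 d | d <- cs] <= u :: W}.
  apply: mem_subseq; have := run_heads_subseq (x :: u :: W).
  by rewrite /run_heads Ex /= eqxx.
(* Either [x W] is a single run and [W] increases, or the last head in [x W] is a letter of [W] and
   exceeds [y], against [lty]. *)
case: cs pcs lty Ex csW => [_ _ Ex _|d cs pcs lty Ex csW].
  have := runs_flatten (x :: u :: W); have := runs_increasing (x :: u :: W).
  by rewrite Ex /= andbT cats0 => /path_sorted pc [Ec]; rewrite Ec in pc.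
move: lty; rewrite /=.
have /csW /(allP yW) : last (head 0 d) [seq head 0 d | d <- cs]
    \in [seq head 0 d | d <- d :: cs] by exact: mem_last.
by move=> /= /ltnW; rewrite leqNgt => /negbTE->.
Qed.

(** A nonempty [W] makes [x W] a run of its own, closed by the descent to [y]; with [W] empty, [x]
    only prolongs the run of [y] to the left. *)
Lemma size_runs_split x W y v : x < y -> all (ltn y) W -> sorted ltn W ->
  size (runs (x :: W ++ y :: v)) = size (runs (y :: v)) + (W != [::]).
Proof.
move=> xy yW Ws; case: W yW Ws => [_ _|u W yW Ws].
  have [b [bs Ey]] := runs_cons y v; rewrite /= in Ey *.
  by rewrite Ey xy addn0.
have ley : y <= last x (u :: W) by have /(allP yW)/ltnW := mem_last u W.
rewrite (runs_catr v ley) size_cat runs_sorted ?addn1 //.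
rewrite (path_sortedE ltn_trans) Ws andbT.
by apply/allP => t /(allP yW) /=; apply: ltn_trans.
Qed.

Lemma rl_minima_cons x w : rl_minima (x :: w) = all (ltn x) w + rl_minima w.
Proof.
rewrite /rl_minima [size _]/= [iota 0 _]/= [count _ _]/= drop0; congr (_ + _).
by rewrite -[1]addn0 iotaDl count_map; apply: eq_count => i.
Qed.

(** The letter [x] is below everything after it, while each letter of [W] has the smaller [y] to its
    right. *)
Lemma rl_minima_split x W y v :
  x < y -> all (ltn y) W -> all (ltn y) v ->
  rl_minima (x :: W ++ y :: v) = (rl_minima (y :: v)).+1.
Proof.
move=> xy yW yv; rewrite rl_minima_cons.
have -> : all (ltn x) (W ++ y :: v).
  rewrite all_cat /= xy /=; apply/andP; split; apply/allP => t.
    by move=> /(allP yW) /=; apply: ltn_trans.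
  by move=> /(allP yv) /=; apply: ltn_trans.
rewrite add1n; congr _.+1; elim: W yW => [//|u W IHW] /= /andP[yu /IHW E].
by rewrite rl_minima_cons E all_cat /= ltnNge (ltnW yu) /= andbF.
Qed.

(** * Distributing a list into two complementary sublists *)

(** This enumerates the choices of the letters of [W]. Both parts keep the order of [s], so the
    parts of an increasing list are increasing. *)
Fixpoint splits (T : Type) (s : seq T) : seq (seq T * seq T) :=
  if s is x :: s' then
    [seq (x :: p.1, p.2) | p <- splits s'] ++
    [seq (p.1, x :: p.2) | p <- splits s']
  else [:: ([::], [::])].

Lemma splits_perm (T : eqType) (s : seq T) p :
  p \in splits s -> perm_eq (p.1 ++ p.2) s.
Proof.
elim: s p => [|x s IHs] p /=; first by rewrite inE => /eqP->.
rewrite mem_cat => /orP[] /mapP[q /IHs pq ->] /=; first by rewrite perm_cons.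
by rewrite -cat1s perm_catCA perm_cons.
Qed.

Lemma splits_subseq (T : eqType) (s : seq T) p :
  p \in splits s -> subseq p.1 s && subseq p.2 s.
Proof.
elim: s p => [|x s IHs] p; first by rewrite inE => /eqP->.
rewrite [splits _]/= mem_cat => /orP[] /mapP[q /IHs /andP[s1 s2] ->].
  by rewrite /= eqxx s1 /=; apply: subseq_trans s2 (subseq_cons _ _).
by rewrite /= eqxx s2 andbT; apply: subseq_trans s1 (subseq_cons _ _).
Qed.

Lemma filter_splits (T : eqType) (P : pred T) s :
  (filter P s, filter (predC P) s) \in splits s.
Proof.
elim: s => [//|x s IHs] /=; rewrite mem_cat.
case: (P x) => /=; apply/orP; [left|right]; apply/mapP.
  by exists (filter P s, filter (predC P) s).
by exists (filter P s, filter (predC P) s).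
Qed.

Lemma splits_uniq (T : eqType) (s : seq T) : uniq s -> uniq (splits s).
Proof.
elim: s => [//|x s IHs] /andP[xs /IHs us] /=.
rewrite cat_uniq !map_inj_uniq ?us; last 2 first.
- by move=> [p1 p2] [q1 q2] /= [-> ->].
- by move=> [p1 p2] [q1 q2] /= [-> ->].
(* The two halves are disjoint: [x] is in the first component of every pair of one half and of no
   pair of the other. *)
rewrite andbT /=; apply/hasPn => _ /mapP[p pin ->]; apply/negP => /mapP[q _ [E _]].
move/splits_subseq: pin => /andP[/mem_subseq/(_ x)]; rewrite E mem_head => /(_ isT).
by rewrite (negbTE xs).
Qed.

(** The head of the list goes left or right, which is Pascal's rule. *)
Lemma sum_splits (T : Type) (f : nat -> nat -> nat) (s : seq T) :
  \sum_(p <- splits s) f (size p.1) (size p.2) =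
  \sum_(i < (size s).+1) 'C(size s, i) * f i (size s - i).
Proof.
elim: s f => [|x s IHs] f.
  by rewrite big_seq1 big_ord1 mul1n.
rewrite /= big_cat !big_map /= (IHs (fun i j => f i.+1 j)) (IHs (fun i j => f i j.+1)).
rewrite [RHS]big_ord_recl /= bin0 subn0.
under [in RHS]eq_bigr => i _ do rewrite /= binS mulnDl subSS.
rewrite big_split /= addnA [RHS]addnC; congr (_ + _).
rewrite big_ord_recl /= bin0 subn0; congr (_ + _).
rewrite [RHS]big_ord_recr /= bin_small // mul0n addn0.
by apply: eq_bigr => i _; rewrite -subSn //= ltn_ord.
Qed.

(** * Weighted sums over run-sorted words and the recurrence *)

(** An arbitrary weight can absorb the shift of both statistics when [x W] is removed, and an
    arbitrary alphabet is needed because the remaining letters need not form an interval. *)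
Definition rs_sum (F : nat -> nat -> nat) (s : seq nat) : nat :=
  \sum_(w <- permutations s | rsorted w) F (size (runs w)) (rl_minima w).

Lemma rsorted_perm_cons y V w : all (ltn y) V -> rsorted w ->
  perm_eq w (y :: V) -> exists2 v, w = y :: v & perm_eq v V.
Proof.
move=> yV; case: w => [|z v] rw pw; first by move/perm_size: pw.
suff E : z = y by rewrite E in rw pw *; exists v => //; rewrite perm_cons in pw.
have zy : z <= y by apply: rsorted_head_min rw _; rewrite (perm_mem pw) mem_head.
have : z \in y :: V by rewrite -(perm_mem pw) mem_head.
rewrite inE => /orP[/eqP //|/(allP yV) /=].
by rewrite ltnNge zy.
Qed.

(** Both lists are duplicate-free, so it suffices that cutting at [y] is injective and that the two
    lists have the same members. *)
Lemma rsorted_words_decomp x y t : sorted ltn [:: x, y & t] ->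
  perm_eq [seq w <- permutations [:: x, y & t] | rsorted w]
    [seq x :: p.1 ++ w | p <- splits t,
       w <- [seq w <- permutations (y :: p.2) | rsorted w]].
Proof.
move=> st.
have /= /and3P[xyt yt ut] : uniq [:: x, y & t] by exact: sorted_uniq ltn_trans ltnn _ st.
move: (st) => /= /andP[xy pt].
have ltyt : all (ltn y) t := order_path_min ltn_trans pt.
have tsort : sorted ltn t := path_sorted pt.
have ymin V w : w \in [seq w <- permutations (y :: V) | rsorted w] ->
    {subset V <= t} -> exists2 v, w = y :: v & perm_eq v V.
  rewrite mem_filter mem_permutations => /andP[rw pw] Vt.
  by apply: rsorted_perm_cons rw pw; apply/allP => z /Vt /(allP ltyt).
apply: uniq_perm.
- exact: filter_uniq (permutations_uniq _).
- apply: allpairs_uniq_dep => [|p _|].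
  + exact: splits_uniq.
  + exact: filter_uniq (permutations_uniq _).
  move=> _ _ /allpairsPdep[p [w [pin win ->]]] /allpairsPdep[q [w' [qin win' ->]]] /= [E].
  have /andP[/mem_subseq p1t /mem_subseq p2t] := splits_subseq pin.
  have /andP[/mem_subseq q1t /mem_subseq q2t] := splits_subseq qin.
  have [v Ew pv] := ymin _ _ win p2t; have [v' Ew' pv'] := ymin _ _ win' q2t.
  subst w w'.
  (* As [y] does not occur in the prefixes, its first occurrence determines where to cut. *)
  have E1 (s1 s2 r1 r2 : seq nat) : y \notin s1 -> y \notin s2 ->
      s1 ++ y :: r1 = s2 ++ y :: r2 -> s1 = s2 /\ r1 = r2.
    elim: s1 s2 => [|u s1 IH] [|u2 s2] //=; rewrite ?inE.
    + by move=> _ _ [->].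
    + by move=> _ + [e]; rewrite e eqxx.
    + by move=> + _ [e]; rewrite e eqxx.
    + by move=> /norP[_ n1] /norP[_ n2] [-> /(IH _ n1 n2)[-> ->]].
  have [e1 e2] := E1 _ _ _ _ (contra (@p1t y) yt) (contra (@q1t y) yt) E.
  (* Both second parts are increasing with the letters of the same word [v], hence equal. *)
  suff e3 : p.2 = q.2.
    by move: p q e1 e2 e3 {pin qin win win' E p1t p2t q1t q2t pv pv'}
      => [p1 p2] [q1 q2] /= -> -> ->.
  have /andP[_ sp] := splits_subseq pin; have /andP[_ sq] := splits_subseq qin.
  apply: (irr_sorted_eq ltn_trans ltnn).
  + exact: subseq_sorted ltn_trans _ _ sp tsort.
  + exact: subseq_sorted ltn_trans _ _ sq tsort.
  by move=> z; rewrite -(perm_mem pv) -(perm_mem pv') e2.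
move=> w; apply/idP/allpairsPdep.
  rewrite mem_filter mem_permutations => /andP[rw pw].
  have [w' Ew pw'] := rsorted_perm_cons (order_path_min ltn_trans st) rw pw.
  subst w; have yw : y \in w' by rewrite (perm_mem pw') mem_head.
  case/splitPr: yw {pw} pw' rw => W v pw rw.
  have pWv : perm_eq (W ++ v) t.
    by rewrite -(perm_cons y) -(permPr pw) perm_sym -cat1s perm_catCA.
  have yW : all (ltn y) W.
    by apply/allP => z zW; apply: (allP ltyt); rewrite -(perm_mem pWv) mem_cat zW.
  have yv : all (ltn y) v.
    by apply/allP => z zv; apply: (allP ltyt); rewrite -(perm_mem pWv) mem_cat zv orbT.
  move: rw; rewrite rsorted_split // => /andP[sW rv].
  have uWv : uniq (W ++ v) by rewrite (perm_uniq pWv).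
  (* An increasing [W] is the sublist of [t] selected by membership in [W], which exhibits it as the
     first part of a splitting. *)
  have eW : W = filter [in W] t.
    apply: (irr_sorted_eq ltn_trans ltnn) => // [|z].
      exact: sorted_filter ltn_trans _ _ tsort.
    rewrite mem_filter -(perm_mem pWv) mem_cat; by case: (z \in W).
  exists (filter [in W] t, filter (predC [in W]) t), (y :: v).
  split; rewrite ?filter_splits -?eW //.
  rewrite mem_filter rv mem_permutations perm_cons /=.
  apply: uniq_perm; first by move: uWv; rewrite cat_uniq => /and3P[].
    exact: filter_uniq.
  move=> z; rewrite mem_filter -(perm_mem pWv) mem_cat /=.
  case zW: (z \in W) => //=; apply/negbTE.
  by move: uWv; rewrite cat_uniq => /and3P[_ /hasPn/(_ z)/contraL /(_ zW)].
move=> [p [w' [pin win ->]]].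
have /andP[sub1 sub2] := splits_subseq pin.
have [v Ew pv] := ymin _ _ win (mem_subseq sub2); subst w'.
move: win; rewrite !mem_filter !mem_permutations => /andP[rv _].
rewrite rsorted_split // ?rv ?andbT.
- rewrite (subseq_sorted ltn_trans sub1 tsort) /= perm_cons.
  rewrite -cat1s perm_catCA perm_cons; apply: perm_trans (splits_perm pin).
  by rewrite perm_cat2l.
- by apply/allP => z /(mem_subseq sub1)/(allP ltyt).
- by apply/allP => z; rewrite (perm_mem pv) => /(mem_subseq sub2)/(allP ltyt).
Qed.

Lemma rs_sum_splits F x y t : sorted ltn [:: x, y & t] ->
  rs_sum F [:: x, y & t] =
  \sum_(p <- splits t)
     rs_sum (fun k r => F (k + (size p.1 > 0)) r.+1) (y :: p.2).
Proof.
move=> st; rewrite /rs_sum -big_filter (perm_big _ (rsorted_words_decomp st)) /=.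
rewrite big_allpairs_dep /= [LHS]big_seq [RHS]big_seq; apply: eq_bigr => p pin.
rewrite -[RHS]big_filter big_seq [RHS]big_seq; apply: eq_bigr => w.
rewrite mem_filter mem_permutations => /andP[rw pw].
have /= /andP[xy pt] := st; have ltyt := order_path_min ltn_trans pt.
have /andP[sub1 sub2] := splits_subseq pin.
have y1 : all (ltn y) p.1 by apply/allP => z /(mem_subseq sub1)/(allP ltyt).
have y2 : all (ltn y) p.2 by apply/allP => z /(mem_subseq sub2)/(allP ltyt).
have [v Ew pv] := rsorted_perm_cons y2 rw pw; subst w.
rewrite rl_minima_split //; last by rewrite (perm_all _ pv).
rewrite size_runs_split //; last exact: subseq_sorted ltn_trans _ _ sub1 (path_sorted pt).
by rewrite lt0n size_eq0.
Qed.

(** By induction on the length, the inner sums depend only on the sizes of the two parts, and the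
    number of splittings with given sizes depends only on the length. *)
Lemma rs_sum_size F s : sorted ltn s -> rs_sum F s = rs_sum F (iota 1 (size s)).
Proof.
have [m] := ubnP (size s); elim: m F s => // m IHm F [|x [|y t]] //= lt_m st.
  by rewrite /rs_sum /permutations /= !big_cons !big_nil.
pose f i j := rs_sum (fun k r => F (k + (i > 0)) r.+1) (iota 1 j.+1).
(* The right-hand side mentions only [t], so the claim applies both to the given list and to the
   interval. *)
suff E z1 z2 u : size u = size t -> sorted ltn [:: z1, z2 & u] ->
    rs_sum F [:: z1, z2 & u] = \sum_(p <- splits t) f (size p.1) (size p.2).
  rewrite !E ?size_iota //; exact: (iota_ltn_sorted 1 (size t).+2).
move=> su su_s; rewrite rs_sum_splits // sum_splits -su -sum_splits.
rewrite big_seq [RHS]big_seq; apply: eq_bigr => p pin.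
have /andP[sub1 sub2] := splits_subseq pin.
rewrite IHm //=; first by rewrite ltnS -su in lt_m; apply: leq_trans lt_m; rewrite !ltnS size_subseq.
by have /= /andP[_ /(subseq_path ltn_trans sub2)] := su_s.
Qed.

Lemma rs_sum_rec F n : rs_sum F (iota 1 n.+2) =
  \sum_(i < n.+1) 'C(n, i) *
    rs_sum (fun k r => F (k + (i > 0)) r.+1) (iota 1 (n - i).+1).
Proof.
pose f i j := rs_sum (fun k r => F (k + (i > 0)) r.+1) (iota 1 j.+1).
have st := iota_ltn_sorted 1 n.+2.
have := sum_splits f (iota 3 n); rewrite size_iota => <-; rewrite rs_sum_splits //.
rewrite big_seq [RHS]big_seq; apply: eq_bigr => p pin; rewrite rs_sum_size //=.
have /andP[_ sub2] := splits_subseq pin.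
exact: (subseq_path ltn_trans sub2 (iota_ltn_sorted 2 n.+1)).
Qed.

Lemma a_rs_sum n k r :
  a n k r = rs_sum (fun k' r' => (k' == k) && (r' == r) : nat) (iota 1 n).
Proof.
rewrite /a /rs_sum -sum1_count [LHS]big_mkcond [RHS]big_mkcond.
rewrite [LHS]big_seq [RHS]big_seq; apply: eq_bigr => w win.
rewrite (run_sorted_minima win) -/(rsorted w).
by case: (rsorted w) => //=; case: (_ && _).
Qed.

(** The index [i] is the length of [W]. The guard rules out truncated subtraction: in the excluded
    cases no word has the required statistics. *)
Lemma a_rec n k r : a n.+2 k r =
  \sum_(i < n.+1) 'C(n, i) *
    (if ((i > 0) <= k) && (0 < r) then a (n - i).+1 (k - (i > 0)) r.-1 else 0).
Proof.
rewrite a_rs_sum rs_sum_rec; apply: eq_bigr => i _; congr (_ * _).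
case: ifP => [/andP[ik r0]|nik].
  rewrite a_rs_sum; apply: eq_bigr => w _; congr (_ && _ : bool) => //.
    by case: (0 < i) ik => ik; apply/eqP/eqP; lia.
  by apply/eqP/eqP; lia.
apply: big1 => w _; case: eqP => // e1; case: eqP => // e2.
by move: nik; rewrite -e1 -e2 leq_addl.
Qed.

Lemma a1 k r : a 1 k r = (k == 1) && (r == 1).
Proof.
rewrite a_rs_sum /rs_sum /permutations /= big_cons big_nil /=.
by rewrite addn0 eq_sym [in RHS](eq_sym r).
Qed.

(** * Power series *)

Local Open Scope ring_scope.

Lemma coef_fpsM (f g : fps) n k r : (f * g) n k r =
  \sum_(i < n.+1) \sum_(j < k.+1) \sum_(l < r.+1)
    f i j l * g (n - i)%N (k - j)%N (r - l)%N.
Proof. by []. Qed.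

Lemma deriv_xM f g : deriv_x (f * g) = deriv_x f * g + f * deriv_x g.
Proof.
apply/fpsP => n k r.
rewrite -[RHS]/((deriv_x f * g) n k r + (f * deriv_x g) n k r) /deriv_x !coef_fpsM.
pose S i i' := \sum_(j < k.+1) \sum_(l < r.+1) f i j l * g i' (k - j)%N (r - l)%N.
have Sl c i i' : \sum_(j < k.+1) \sum_(l < r.+1) c * f i j l * g i' (k - j)%N (r - l)%N
    = c * S i i'.
  rewrite /S mulr_sumr; apply: eq_bigr => j _; rewrite mulr_sumr.
  by apply: eq_bigr => l _; rewrite mulrA.
have Sr c i i' : \sum_(j < k.+1) \sum_(l < r.+1) f i j l * (c * g i' (k - j)%N (r - l)%N)
    = c * S i i'.
  rewrite -Sl; apply: eq_bigr => j _; apply: eq_bigr => l _; ring.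
under [X in _ = X + _]eq_bigr => i _ do rewrite Sl.
under [X in _ = _ + X]eq_bigr => i _ do rewrite Sr.
rewrite -[LHS]/(n.+1%:R * \sum_(i < n.+2) S i (n.+1 - i)%N) mulr_sumr.
(* Write the factor [n.+1] as [i + (n.+1 - i)]; each half has one vanishing end term, and the rest
   matches one summand of the product rule. *)
have -> : \sum_(i < n.+2) n.+1%:R * S i (n.+1 - i)%N =
   \sum_(i < n.+2) i%:R * S i (n.+1 - i)%N +
   \sum_(i < n.+2) (n.+1 - i)%:R * S i (n.+1 - i)%N.
  rewrite -big_split /=; apply: eq_bigr => i _; rewrite -mulrDl -natrD.
  by rewrite subnKC // -ltnS.
congr (_ + _).
  by rewrite big_ord_recl mul0r add0r; apply: eq_bigr => i _; rewrite /= subSS.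
rewrite big_ord_recr /= subnn mul0r addr0.
by apply: eq_bigr => i _; rewrite subSn // -ltnS.
Qed.

Lemma deriv_xD f g : deriv_x (f + g) = deriv_x f + deriv_x g.
Proof. by apply/fpsP => n k r; exact: mulrDr. Qed.

Lemma deriv_xN f : deriv_x (- f) = - deriv_x f.
Proof. by apply/fpsP => n k r; exact: mulrN. Qed.

Lemma deriv_x1 : deriv_x 1 = 0.
Proof. by apply/fpsP => n k r; rewrite /deriv_x mulr0. Qed.

Lemma deriv_xY : deriv_x Y = 0.
Proof. by apply/fpsP => n k r; rewrite /deriv_x mulr0. Qed.

Lemma deriv_xZ : deriv_x Z = 0.
Proof. by apply/fpsP => n k r; rewrite /deriv_x mulr0. Qed.

Lemma deriv_xX : deriv_x X = 1.
Proof.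
apply/fpsP => n k r; rewrite /deriv_x /X /monomial eqSS.
by case: n => [|n]; rewrite ?mul1r //= mulr0.
Qed.

Lemma deriv_x_expr f m : deriv_x (f ^+ m.+1) = (f ^+ m * deriv_x f) *+ m.+1.
Proof.
elim: m => [|m IHm]; first by rewrite expr1 expr0 mul1r.
by rewrite exprS deriv_xM IHm [f ^+ m.+1]exprS; ring.
Qed.

Lemma coef_fpsMn (f : fps) m n k r : (f *+ m) n k r = f n k r *+ m.
Proof.
by elim: m => [//|m IHm]; rewrite !mulrS -IHm.
Qed.

Lemma deriv_x_exp (f : fps) : f 0%N 0%N 0%N = 0 ->
  deriv_x (fps_exp f) = fps_exp f * deriv_x f.
Proof.
move=> f0; apply/fpsP => n k r; pose N := (n + k + r).+1.
rewrite /deriv_x (@fps_exp_stable _ N.+1) //.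
rewrite mulr_sumr big_ord_recl /= expr0.
rewrite [X in _ * (X / _)](_ : _ = 0) // mul0r mulr0 add0r coef_fpsM.
(* The term with [m = 0] has zero derivative, and the derivative of [f ^+ m.+1 / m.+1]![is]f ^+ m *
   deriv_x f / m[!]. *)
have -> : \sum_(m < N) n.+1%:R * ((f ^+ m.+1) n.+1 k r / m.+1`!%:R) =
          \sum_(m < N) (f ^+ m * deriv_x f) n k r / m`!%:R.
  apply: eq_bigr => m _; rewrite mulrA -[n.+1%:R * _]/(deriv_x (f ^+ m.+1) n k r).
  rewrite deriv_x_expr coef_fpsMn factS natrM -mulr_natl.
  by field; rewrite nat1r !pnatr_eq0 -lt0n fact_gt0.
under eq_bigr => m _ do rewrite coef_fpsM mulr_suml.
rewrite exchange_big; apply: eq_bigr => i _.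
under eq_bigr => m _ do rewrite mulr_suml.
rewrite exchange_big; apply: eq_bigr => j _.
under eq_bigr => m _ do rewrite mulr_suml.
rewrite exchange_big; apply: eq_bigr => l _.
(* Since [i], [j], [l] are at most [n], [k], [r], the single bound [N] truncates every exponential
   coefficient in the product. *)
rewrite (@fps_exp_stable _ N) //; last first.
  by rewrite /N; move: (ltn_ord i) (ltn_ord j) (ltn_ord l); lia.
by rewrite mulr_suml; apply: eq_bigr => m _; rewrite mulrAC.
Qed.

Lemma at_x0_exp (f : fps) : (forall k r, f 0%N k r = 0) -> at_x0 (fps_exp f) = 1.
Proof.
move=> f0; apply/fpsP => n k r; rewrite /at_x0; case: n => [|n] //=.
rewrite /fps_exp big_ord_recl big1 => [|m _].
  by rewrite addr0 expr0 divr1.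
rewrite exprS coef_fpsM big_ord1 big1 ?mul0r // => j _; rewrite big1 // => l _.
by rewrite f0 mul0r.
Qed.

Lemma at_x0D f g : at_x0 (f + g) = at_x0 f + at_x0 g.
Proof. by apply/fpsP => -[|n] k r //; exact: esym (addr0 0). Qed.

Lemma at_x0N f : at_x0 (- f) = - at_x0 f.
Proof. by apply/fpsP => -[|n] k r //; exact: esym oppr0. Qed.

Lemma at_x0M f g : at_x0 (f * g) = at_x0 f * at_x0 g.
Proof.
apply/fpsP => -[|n] k r; rewrite /at_x0 [in RHS]coef_fpsM ?coef_fpsM.
  by rewrite !big_ord1.
rewrite /= big1 // => i _; rewrite big1 // => j _; rewrite big1 // => l _.
case: (i : nat) => [|i']; first by rewrite subn0 mulr0.
by rewrite mul0r.
Qed.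

(** The equation expresses the coefficients at [n.+1] through those at indices up to [n], so the
    value at [x = 0] determines the solution. *)
Lemma deriv_x_ode_unique f g h : deriv_x f = f * h -> deriv_x g = g * h ->
  at_x0 f = at_x0 g -> f = g.
Proof.
move=> Df Dg fg0; apply/fpsP => n; elim/ltn_ind: n => -[|n] IHn k r.
  by have := congr1 (fun u : fps => u 0%N k r) fg0.
apply: (@mulfI _ n.+1%:R); first by rewrite pnatr_eq0.
rewrite -[LHS]/(deriv_x f n k r) -[RHS]/(deriv_x g n k r) Df Dg !coef_fpsM.
by apply: eq_bigr => i _; apply: eq_bigr => j _; apply: eq_bigr => l _; rewrite IHn.
Qed.

Lemma coef_fps_expX n k r : fps_exp X n k r = ((k == 0%N) && (r == 0%N))%:R / n`!%:R.
Proof.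
elim: n k r => [|n IHn] k r.
  have /(congr1 (fun u : fps => u 0%N k r)) : at_x0 (fps_exp X) = 1.
    by apply: at_x0_exp.
  by rewrite divr1.
apply: (@mulfI _ n.+1%:R); first by rewrite pnatr_eq0.
rewrite -[LHS]/(deriv_x (fps_exp X) n k r) deriv_x_exp ?X_const0 // deriv_xX mulr1 IHn.
by rewrite factS natrM; field; rewrite nat1r !pnatr_eq0 -lt0n fact_gt0.
Qed.

Lemma coef_monomialM i j l f n k r : (monomial i j l * f) n k r =
  if [&& i <= n, j <= k & l <= r]%N then f (n - i)%N (k - j)%N (r - l)%N else 0.
Proof.
rewrite coef_fpsM /monomial.
case: (leqP i n) => /= [lei|gti]; last first.
  rewrite big1 // => i' _; rewrite big1 // => j' _; rewrite big1 // => l' _.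
  by rewrite ltn_eqF ?mul0r //; apply: leq_trans gti.
rewrite (bigD1 (Ordinal (lei : (i < n.+1)%N))) //= [X in _ + X]big1 ?addr0; last first.
  move=> i' ne; rewrite big1 // => j' _; rewrite big1 // => l' _.
  by rewrite -val_eqE /= in ne; rewrite (negbTE ne) mul0r.
case: (leqP j k) => /= [lej|gtj]; last first.
  rewrite big1 // => j' _; rewrite big1 // => l' _.
  by rewrite (@ltn_eqF j') ?andbF ?mul0r //; apply: leq_trans gtj.
rewrite (bigD1 (Ordinal (lej : (j < k.+1)%N))) //= [X in _ + X]big1 ?addr0; last first.
  move=> j' ne; rewrite big1 // => l' _.
  by rewrite -val_eqE /= in ne; rewrite (negbTE ne) andbF mul0r.
case: (leqP l r) => /= [lel|gtl]; last first.
  rewrite big1 // => l' _.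
  by rewrite (@ltn_eqF l') ?andbF ?mul0r //; apply: leq_trans gtl.
rewrite (bigD1 (Ordinal (lel : (l < r.+1)%N))) //= [X in _ + X]big1 ?addr0; last first.
  move=> l' ne.
  by rewrite -val_eqE /= in ne; rewrite (negbTE ne) !andbF mul0r.
by rewrite !eqxx mul1r.
Qed.

(** * The differential equation satisfied by [deriv_x A] *)

Lemma deriv_xA n k r : deriv_x A n k r = (a n.+1 k r)%:R / n`!%:R.
Proof.
rewrite /deriv_x /A factS natrM.
by field; rewrite nat1r !pnatr_eq0 -lt0n fact_gt0.
Qed.

Lemma at_x0_deriv_xA : at_x0 (deriv_x A) = Y * Z.
Proof.
apply/fpsP => n k r; rewrite /at_x0 coef_monomialM subn0 /Z /monomial.
case: n => [|n] /=; last by rewrite if_same.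
rewrite deriv_xA a1 divr1 subn0.
by case: k => [|k] //=; rewrite subSS subn0.
Qed.

(** This is the exponential generating function for the choice of [W] with [i] letters: one factor
    [z] always, and one factor [y] when [W] is nonempty. *)
Lemma coef_log_deriv i j l : (Z + Y * Z * (fps_exp X - 1)) i j l =
  ((j == (0 < i)%N) && (l == 1%N))%:R / i`!%:R.
Proof.
have B n k r : (fps_exp X - 1) n k r = fps_exp X n k r - monomial 0 0 0 n k r.
  by [].
rewrite -mulrA -[LHS]/(Z i j l + (Y * (Z * (fps_exp X - 1))) i j l).
rewrite !coef_monomialM /= !subn0 B coef_fps_expX /Z /monomial.
case: i => [|i]; case: j => [|[|j]]; case: l => [|[|l]];
  rewrite /= ?subr0 ?subrr ?divr1 ?mul0r ?subr0 ?addr0 ?add0r //.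
Qed.

Lemma deriv_x2A : deriv_x (deriv_x A) = deriv_x A * (Z + Y * Z * (fps_exp X - 1)).
Proof.
apply/fpsP => n k r; rewrite [LHS]/deriv_x deriv_xA a_rec [_ * (_ + _)]mulrC coef_fpsM.
rewrite natr_sum mulrC !mulr_suml; apply: eq_bigr => i _.
have le_in : (i <= n)%N by rewrite -ltnS.
(* For fixed [i] the sums over [j] and [l] form the coefficient of a product with a monomial in [y]
   and [z], which [coef_monomialM] reduces to one shifted term. *)
transitivity ((monomial 0 (0 < i)%N 1 *
    (fun _ k r => deriv_x A (n - i)%N k r / i`!%:R : rat)) 0%N k r); last first.
  rewrite coef_fpsM big_ord1; apply: eq_bigr => j _; apply: eq_bigr => l _.
  by rewrite coef_log_deriv /monomial /=; ring.
rewrite coef_monomialM /= natrM; case: ifP => _; last by rewrite mulr0 !mul0r.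
rewrite deriv_xA subn1 [n.+1`!]factS -(bin_fact le_in) !natrM.
have f0 m : m`!%:R != 0 :> rat by rewrite pnatr_eq0 -lt0n fact_gt0.
have b0 : 'C(n, i)%:R != 0 :> rat by rewrite pnatr_eq0 -lt0n bin_gt0.
by field; rewrite !f0 b0 nat1r pnatr_eq0.
Qed.

Theorem theorem30 :
  deriv_x A =
    Y * Z * fps_exp (X * Z + Y * Z * (- X - 1) + Y * Z * fps_exp X) /\
  at_x0 (deriv_x A) = Y * Z.
Proof.
split; last exact: at_x0_deriv_xA.
set g := X * Z + _ + _.
have Dg : deriv_x g = Z + Y * Z * (fps_exp X - 1).
  rewrite /g !(deriv_xD, deriv_xM, deriv_xN, deriv_xX, deriv_xY, deriv_xZ, deriv_x1).
  rewrite deriv_x_exp ?X_const0 // deriv_xX; ring.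
apply: (@deriv_x_ode_unique _ _ (Z + Y * Z * (fps_exp X - 1))).
- exact: deriv_x2A.
- rewrite !deriv_xM deriv_xY deriv_xZ deriv_x_exp ?Dg; first by ring.
  exact: exponent_const0.
have X0 : at_x0 X = 0 by apply/fpsP => -[|n] k r.
have Y0 : at_x0 Y = Y by apply/fpsP => -[|n] k r.
have Z0 : at_x0 Z = Z by apply/fpsP => -[|n] k r.
have one0 : at_x0 1 = 1 by apply/fpsP => -[|n] k r.
(* At [x = 0] the terms [-yz] and [yz e^0] cancel, so the exponential has value 1 there. *)
have g0 : at_x0 g = 0.
  rewrite /g !(at_x0D, at_x0M, at_x0N, X0, Y0, Z0, one0) at_x0_exp //; ring.
rewrite at_x0_deriv_xA !at_x0M Y0 Z0 at_x0_exp ?mulr1 // => k r.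
exact: (congr1 (fun u : fps => u 0%N k r) g0).
Qed.
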